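(* Let $i\in[\ell]$ be fixed, let $A_i,D_i,L_i,C,\zeta,T,X_i$, $P_i$, $\Psi_i(t)$ and $\vartheta_i$ be as in the context, and let $0=\tau_0<\tau_1<\dots<\tau_M=T$ be a grid on $[0,T]$. Given $\varepsilon,\zeta>0$ and $\alpha\in(0,\zeta)$, assume that $$\max_{0\le j\le M-1}(\tau_{j+1}-\tau_j)<\mu$$ for some $\mu>0$ with $\vartheta_i(\mu)<\dfrac{\varepsilon}{2(\zeta-\alpha+\|L_iD_i\|)}$. Let $h,\gamma,\kappa>0$ and symmetric $W,Q\succ0$ in $\mathbb R^{n\times n}$ be such that $\Psi_i(\tau_k)\prec-\varepsilon I_{4n}$ for all $k\in\{1,\dots,M\}$. Then $\Psi_i(t)\prec0$ for all $t\in[0,T]$.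
   Context: Notation: $\|\cdot\|$ is the operator norm induced by the Euclidean norm; $\prec,\succ$ denote definiteness of symmetric matrices; $\star$ denotes entries determined by symmetry. Data: $A_i\in\mathbb R^{n\times n}$, $D_i\in\mathbb R^{m\times n}$, $L_i\in\mathbb R^{n\times m}$, $C\in\mathbb R^{p\times n}$, $T>0$, symmetric $X_i\succ0$ in $\mathbb R^{n\times n}$; $U_i:=A_i-L_iD_i$, $\Phi_i(\alpha,Q):=U_i^\top Q+QU_i+2\alpha Q$, $A_{i,\zeta}:=A_i+\zeta I_n$. $P_i:[0,T]\to\mathbb R^{n\times n}$ is the (symmetric positive definite) solution of $-\dot P_i(t)=A_i^\top P_i(t)+P_i(t)A_i+C^\top C+2\zeta P_i(t)$ on $[0,T)$ with $P_i(T)=X_i$. $\mathbf P_i:=(\|X_i\|+T\|C^\top C\|)\,\mathrm e^{2T\|A_{i,\zeta}\|}$ and, for $\mu>0$, $$\vartheta_i(\mu):=\mu\,\mathrm e^{2\|A_{i,\zeta}\|\mu}\|C^\top C\|+\Big[2\big(\mathrm e^{\|A_{i,\zeta}\|\mu}-1\big)+\big(\mathrm e^{\|A_{i,\zeta}\|\mu}-1\big)^2\Big]\mathbf P_i .$$ With $c:=h^2\mathrm e^{2\alpha h}$, $$\Psi_i(t)=\begin{bmatrix}-2(\zeta-\alpha)P_i(t)+\gamma\kappa^2I_n & P_i(t)L_iD_i+\gamma\kappa^2I_n & -P_i(t)L_iD_i & 0\\ \star&\Phi_i(\alpha,Q)+\gamma\kappa^2I_n+cU_i^\top WU_i& QL_iD_i+cU_i^\top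 WL_iD_i& Q+cU_i^\top W\\ \star&\star&-\frac{\pi^2}{4}W+cD_i^\top L_i^\top WL_iD_i& cD_i^\top L_i^\top W\\ \star&\star&\star&-\gamma I_n+cW\end{bmatrix}\in\mathbb R^{4n\times4n}.$$ *)

(* Defs.v *)
From HB Require Import structures.
From mathcomp Require Export all_boot all_order all_algebra.
From mathcomp Require Export all_classical all_reals all_analysis.
Export Order.TTheory GRing.Theory Num.Theory.
Export numFieldNormedType.Exports.

Set Implicit Arguments.
Unset Strict Implicit.
Unset Printing Implicit Defensive.

#[global] Open Scope classical_set_scope.
#[global] Open Scope ring_scope.

Definition euclnorm (R : realType) (n : nat) (x : 'cV[R]_n) : R :=
  Num.sqrt (\sum_(k < n) x k 0 ^+ 2).

(* The norm [`|A|] that MathComp-Analysis puts on matrices is the entrywise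
   maximum norm, hence this separate operator norm. *)
Definition opnorm (R : realType) (m n : nat) (A : 'M[R]_(m, n)) : R :=
  sup [set euclnorm (A *m x) | x in [set x : 'cV[R]_n | euclnorm x <= 1]].

(* Definiteness includes symmetry. *)
Definition posdef (R : realType) (n : nat) (A : 'M[R]_n) : Prop :=
  A^T = A /\ forall x : 'cV[R]_n, x != 0 -> 0 < (x^T *m A *m x) 0 0.

Definition mxprec (R : realType) (n : nat) (A B : 'M[R]_n) : Prop :=
  posdef (B - A).

(* [symblock A B D] is the block matrix [A, B; *, D], the starred block being
   determined by symmetry. *)
Definition symblock (R : realType) (m n : nat)
    (A : 'M[R]_m) (B : 'M[R]_(m, n)) (D : 'M[R]_n) : 'M[R]_(m + n) :=
  block_mx A B B^T D.

Definition lyap_rhs (R : realType) (n p : nat) (A : 'M[R]_n)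
    (C : 'M[R]_(p, n)) (zeta : R) (P : 'M[R]_n) : 'M[R]_n :=
  A^T *m P + P *m A + C^T *m C + (2 * zeta) *: P.

(* Solution on [0, T) of the terminal value problem
   - P' = lyap_rhs P, P T = X. The terminal value is attained continuously and
   the derivative at 0 is the right derivative; values of P outside [0, T] are
   irrelevant. *)
Definition lyap_solution (R : realType) (n p : nat) (A : 'M[R]_n)
    (C : 'M[R]_(p, n)) (zeta T : R) (X : 'M[R]_n) (P : R -> 'M[R]_n) : Prop :=
  [/\ {within `[0, T], continuous P},
      (forall t, 0 < t < T -> is_derive t (1 : R) P (- lyap_rhs A C zeta (P t))),
      (s^-1 *: (P s - P 0)) @[s --> 0^'+] --> - lyap_rhs A C zeta (P 0)
    & P T = X].

Definition shiftmx (R : realType) (n : nat) (A : 'M[R]_n) (zeta : R) : 'M[R]_n :=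
  A + zeta%:M.

Definition Pbound (R : realType) (n p : nat) (A : 'M[R]_n)
    (C : 'M[R]_(p, n)) (zeta T : R) (X : 'M[R]_n) : R :=
  (opnorm X + T * opnorm (C^T *m C))
  * expR (2 * T * opnorm (shiftmx A zeta)).

Definition vartheta (R : realType) (n p : nat) (A : 'M[R]_n)
    (C : 'M[R]_(p, n)) (zeta T : R) (X : 'M[R]_n) (mu : R) : R :=
  let a := opnorm (shiftmx A zeta) in
  mu * expR (2 * a * mu) * opnorm (C^T *m C)
  + (2 * (expR (a * mu) - 1) + (expR (a * mu) - 1) ^+ 2)
    * Pbound A C zeta T X.

Definition Umx (R : realType) (n m : nat) (A : 'M[R]_n)
    (L : 'M[R]_(n, m)) (D : 'M[R]_(m, n)) : 'M[R]_n :=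
  A - L *m D.

Definition Phi (R : realType) (n m : nat) (A : 'M[R]_n)
    (L : 'M[R]_(n, m)) (D : 'M[R]_(m, n)) (alpha : R) (Q : 'M[R]_n) : 'M[R]_n :=
  (Umx A L D)^T *m Q + Q *m Umx A L D + (2 * alpha) *: Q.

Definition Psi (R : realType) (n m : nat) (A : 'M[R]_n)
    (L : 'M[R]_(n, m)) (D : 'M[R]_(m, n)) (zeta alpha h gamma kappa : R)
    (W Q : 'M[R]_n) (P : R -> 'M[R]_n) (t : R) : 'M[R]_(n + (n + (n + n))) :=
  let c := h ^+ 2 * expR (2 * alpha * h) in
  let U := Umx A L D in
  let LD := L *m D in
  let g : 'M[R]_n := (gamma * kappa ^+ 2)%:M in
  symblock
    (- (2 * (zeta - alpha)) *: P t + g)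
    (row_mx (P t *m LD + g) (row_mx (- (P t *m LD)) 0))
    (symblock
       (Phi A L D alpha Q + g + c *: (U^T *m W *m U))
       (row_mx (Q *m LD + c *: (U^T *m W *m LD)) (Q + c *: (U^T *m W)))
       (symblock
          (- (pi ^+ 2 / 4) *: W + c *: (D^T *m L^T *m W *m L *m D))
          (c *: (D^T *m L^T *m W))
          (- gamma%:M + c *: W))).

(* Main.v *)
(* For [t] in a grid cell ending at [tau], [Psi t - Psi tau] is linear in
   [P t - P tau], and its quadratic form is at most
   [2 (zeta - alpha + |LD|) |P t - P tau|] times the squared norm; so it is enough
   that [|P t - P tau| <= vartheta mu].  Instead of the variation-of-constants
   formula, every bound on [P] comes from a backward Gronwall comparison for the
   scalar functions [u^T Z(s) v], where [- Z' = B^T Z + Z B + G0], against an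
   explicit supersolution [y], i.e. [- y' >= 2 |B| y + |G0|].  It is applied to
   [Z = P] (giving [Pbound]), to [Z = P - P tau] (giving [vartheta], since
   [2 (e - 1) + (e - 1)^2 = e^2 - 1] for [e = expR (a * mu)]), and to
   [Z = P - P^T] with [y = 0] (symmetry of [P]). *)

Require Import Defs.
From HB Require Import structures.
From mathcomp Require Import ring lra.

Set Implicit Arguments.
Unset Strict Implicit.
Unset Printing Implicit Defensive.

(** * Euclidean norm, operator norm and bounds on bilinear forms *)

Section EuclideanNorm.
Variable R : realType.
Implicit Types m n : nat.

Lemma euclnorm_ge0 n (x : 'cV[R]_n) : 0 <= euclnorm x.
Proof. exact: sqrtr_ge0. Qed.

Lemma sqr_euclnorm n (x : 'cV[R]_n) : euclnorm x ^+ 2 = \sum_(k < n) x k 0 ^+ 2.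
Proof. by rewrite sqr_sqrtr// sumr_ge0// => k _; rewrite sqr_ge0. Qed.

Lemma dotmxE n (u v : 'cV[R]_n) : (u^T *m v) 0 0 = \sum_(k < n) u k 0 * v k 0.
Proof. by rewrite mxE; apply: eq_bigr => k _; rewrite mxE. Qed.

Lemma dotmx_norm n (x : 'cV[R]_n) : (x^T *m x) 0 0 = euclnorm x ^+ 2.
Proof.
by rewrite dotmxE sqr_euclnorm; apply: eq_bigr => k _; rewrite expr2.
Qed.

Lemma euclnorm0 n : euclnorm (0 : 'cV[R]_n) = 0.
Proof.
by apply/eqP; rewrite -sqrf_eq0 sqr_euclnorm big1// => k _; rewrite mxE expr0n.
Qed.

Lemma euclnorm_eq0 n (x : 'cV[R]_n) : (euclnorm x == 0) = (x == 0).
Proof.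
apply/idP/eqP => [|->]; last by rewrite euclnorm0.
rewrite -sqrf_eq0 sqr_euclnorm psumr_eq0 => [/allP x0|k _]; last exact: sqr_ge0.
apply/colP => k; rewrite mxE; apply/eqP.
by rewrite -sqrf_eq0; apply: x0; rewrite mem_index_enum.
Qed.

Lemma euclnorm_gt0 n (x : 'cV[R]_n) : (0 < euclnorm x) = (x != 0).
Proof. by rewrite lt0r euclnorm_ge0 andbT euclnorm_eq0. Qed.

Lemma euclnormZ n (a : R) (x : 'cV[R]_n) : 0 <= a ->
  euclnorm (a *: x) = a * euclnorm x.
Proof.
move=> a0; apply/eqP; rewrite -(@eqrXn2 _ 2)// ?mulr_ge0 ?euclnorm_ge0//.
rewrite exprMn !sqr_euclnorm mulr_sumr; apply/eqP/eq_bigr => k _.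
by rewrite mxE exprMn.
Qed.

Lemma euclnormN n (x : 'cV[R]_n) : euclnorm (- x) = euclnorm x.
Proof. by congr Num.sqrt; apply: eq_bigr => k _; rewrite mxE sqrrN. Qed.

Lemma sqr_euclnormB_le n (x y : 'cV[R]_n) :
  euclnorm (x - y) ^+ 2 <= 2 * (euclnorm x ^+ 2 + euclnorm y ^+ 2).
Proof.
rewrite !sqr_euclnorm -big_split mulr_sumr /= ler_sum// => k _.
rewrite !mxE; have := sqr_ge0 (x k 0 + y k 0); nra.
Qed.

Lemma sqr_euclnorm_col_mx m n (x : 'cV[R]_m) (y : 'cV[R]_n) :
  euclnorm (col_mx x y) ^+ 2 = euclnorm x ^+ 2 + euclnorm y ^+ 2.
Proof. by rewrite -!dotmx_norm tr_col_mx mul_row_col mxE. Qed.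

(** Cauchy-Schwarz, from expanding the nonnegative sum of the squares (|v| u_k - |u| v_k)^2. The
    zero vectors are set apart so that the factor |u| |v| can be cancelled. *)
Lemma dotmx_le n (u v : 'cV[R]_n) :
  (u^T *m v) 0 0 <= euclnorm u * euclnorm v.
Proof.
have [->|u0] := eqVneq u 0; first by rewrite trmx0 mul0mx mxE euclnorm0 mul0r.
have [->|v0] := eqVneq v 0; first by rewrite mulmx0 mxE euclnorm0 mulr0.
have uv0 : 0 < euclnorm u * euclnorm v by rewrite mulr_gt0 ?euclnorm_gt0.
rewrite -(ler_pM2l uv0).
have : 0 <= \sum_(k < n) (euclnorm v * u k 0 - euclnorm u * v k 0) ^+ 2.
  by rewrite sumr_ge0// => k _; rewrite sqr_ge0.
suff -> : \sum_(k < n) (euclnorm v * u k 0 - euclnorm u * v k 0) ^+ 2 =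
    2 * ((euclnorm u * euclnorm v) * (euclnorm u * euclnorm v)
         - (euclnorm u * euclnorm v) * (u^T *m v) 0 0).
  by rewrite pmulr_rge0// subr_ge0.
transitivity (euclnorm v ^+ 2 * (\sum_(k < n) u k 0 ^+ 2)
    + euclnorm u ^+ 2 * (\sum_(k < n) v k 0 ^+ 2)
    - 2 * (euclnorm u * euclnorm v) * (\sum_(k < n) u k 0 * v k 0)).
  rewrite !mulr_sumr -big_split -sumrB; apply: eq_bigr => k _ /=; ring.
rewrite -!sqr_euclnorm -dotmxE; ring.
Qed.

(** Cauchy-Schwarz on each row. This crude Frobenius bound shows that the set under the [sup] of
    [opnorm] is bounded above, without which [sup] would bound nothing. *)
Lemma euclnorm_mulmx_frob m n (A : 'M[R]_(m, n)) (x : 'cV[R]_n) :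
  euclnorm (A *m x) <= Num.sqrt (\sum_i \sum_j A i j ^+ 2) * euclnorm x.
Proof.
have A0 : 0 <= \sum_i \sum_j A i j ^+ 2.
  by do 2 (apply: sumr_ge0 => ? _); rewrite sqr_ge0.
rewrite -(@ler_pXn2r _ 2)// ?nnegrE ?mulr_ge0 ?euclnorm_ge0 ?sqrtr_ge0//.
rewrite exprMn sqr_euclnorm (sqr_sqrtr A0) mulr_suml ler_sum// => i _.
have rowE : \sum_j A i j ^+ 2 = euclnorm (row i A)^T ^+ 2.
  by rewrite sqr_euclnorm; apply: eq_bigr => j _; rewrite !mxE.
have dotE (y : 'cV[R]_n) : (A *m y) i 0 = ((row i A)^T^T *m y) 0 0.
  by rewrite trmxK -row_mul [RHS]mxE.
rewrite rowE -exprMn -[leLHS]real_normK ?num_real//.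
rewrite ler_pXn2r// ?nnegrE ?mulr_ge0 ?euclnorm_ge0//.
rewrite ler_norml lerNl dotE dotmx_le andbT.
rewrite -(euclnormN x); have := dotmx_le (row i A)^T (- x).
by rewrite mulmxN mxE.
Qed.

Lemma le_opnorm m n (A : 'M[R]_(m, n)) (x : 'cV[R]_n) :
  euclnorm x <= 1 -> euclnorm (A *m x) <= opnorm A.
Proof.
move=> x1; apply: ub_le_sup; last by exists x.
exists (Num.sqrt (\sum_i \sum_j A i j ^+ 2)) => _ [y /= y1 <-].
apply: le_trans (euclnorm_mulmx_frob _ _) _.
by rewrite ler_piMr// sqrtr_ge0.
Qed.

Lemma opnorm_ge0 m n (A : 'M[R]_(m, n)) : 0 <= opnorm A.
Proof.
by have := @le_opnorm _ _ A 0; rewrite mulmx0 !euclnorm0; apply; exact: ler01.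
Qed.

Lemma euclnorm_mulmx_le m n (A : 'M[R]_(m, n)) (x : 'cV[R]_n) :
  euclnorm (A *m x) <= opnorm A * euclnorm x.
Proof.
have [->|x0] := eqVneq x 0; first by rewrite mulmx0 !euclnorm0 mulr0.
have x_gt0 : 0 < euclnorm x by rewrite euclnorm_gt0.
rewrite -ler_pdivrMr// mulrC -euclnormZ ?invr_ge0 ?euclnorm_ge0// scalemxAr.
by rewrite le_opnorm// euclnormZ ?invr_ge0 ?euclnorm_ge0// mulVf// gt_eqF.
Qed.

(* [bilin_le M c] is the scalarised form of [opnorm M <= c]. *)
Definition bilin_le n (M : 'M[R]_n) (c : R) : Prop :=
  forall u v : 'cV[R]_n, (u^T *m M *m v) 0 0 <= c * (euclnorm u * euclnorm v).

Lemma bilin_le_opnorm n (M : 'M[R]_n) : bilin_le M (opnorm M).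
Proof.
move=> u v; rewrite -mulmxA; apply: le_trans (dotmx_le _ _) _.
by rewrite mulrCA ler_wpM2l ?euclnorm_ge0// euclnorm_mulmx_le.
Qed.

Lemma bilin_leD n (M N : 'M[R]_n) (c d : R) :
  bilin_le M c -> bilin_le N d -> bilin_le (M + N) (c + d).
Proof. by move=> Mc Nd u v; rewrite mulmxDr mulmxDl mxE mulrDl lerD. Qed.

Lemma bilin_leN n (M : 'M[R]_n) (c : R) : bilin_le M c -> bilin_le (- M) c.
Proof.
by move=> Mc u v; rewrite mulmxN mulNmx -mulmxN -(euclnormN v); exact: Mc.
Qed.

Lemma bilin_le_weaken n (M : 'M[R]_n) (c d : R) :
  c <= d -> bilin_le M c -> bilin_le M d.
Proof.
move=> cd Mc u v; apply: le_trans (Mc u v) _.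
by rewrite ler_wpM2r// mulr_ge0 ?euclnorm_ge0.
Qed.

Lemma bilin_le_mulr n (M N : 'M[R]_n) (c : R) : 0 <= c ->
  bilin_le M c -> bilin_le (M *m N) (opnorm N * c).
Proof.
move=> c0 Mc u v; rewrite mulmxA -mulmxA; apply: le_trans (Mc _ _) _.
rewrite [opnorm N * c]mulrC -mulrA ler_wpM2l// mulrCA ler_wpM2l ?euclnorm_ge0//.
exact: euclnorm_mulmx_le.
Qed.

(** A 1 x 1 matrix equals its transpose, so transposing [M] only swaps [u] and [v]. *)
Lemma bilin_le_trmx n (M : 'M[R]_n) (c : R) : bilin_le M c -> bilin_le M^T c.
Proof.
move=> Mc u v; rewrite [euclnorm u * _]mulrC; apply: le_trans (Mc _ _).
suff -> : u^T *m M^T *m v = (v^T *m M *m u)^T by rewrite mxE.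
by rewrite !trmx_mul trmxK mulmxA.
Qed.

Lemma bilin_le_trmxM n (M N : 'M[R]_n) (c : R) : 0 <= c ->
  bilin_le M c -> bilin_le (N^T *m M) (opnorm N * c).
Proof.
move=> c0 Mc; rewrite -[N^T *m M]trmxK trmx_mul trmxK.
by apply/bilin_le_trmx/bilin_le_mulr => //; exact: bilin_le_trmx.
Qed.

(** Link to the maximum norm, in which continuity and boundedness are expressed: each of the n^2
    entries is at most |M|, so the Frobenius norm is at most n |M|. *)
Lemma bilin_le_norm n (M : 'M[R]_n) : bilin_le M (n%:R * `|M|).
Proof.
move=> u v; rewrite -mulmxA; apply: le_trans (dotmx_le _ _) _.
rewrite mulrCA ler_wpM2l ?euclnorm_ge0//.
apply: le_trans (euclnorm_mulmx_frob _ _) _.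
have nM0 : 0 <= n%:R * `|M| by rewrite mulr_ge0.
rewrite ler_wpM2r ?euclnorm_ge0// -(ger0_norm nM0) -sqrtr_sqr ler_wsqrtr//.
apply: (@le_trans _ _ (\sum_(i < n) \sum_(j < n) `|M| ^+ 2)).
  apply: ler_sum => i _; apply: ler_sum => j _.
  rewrite -[leLHS]real_normK ?num_real// ler_pXn2r ?nnegrE//.
  rewrite [leRHS]mx_normrE.
  by rewrite (le_bigmax _ (fun ij => `|M ij.1 ij.2|) (i, j)).
rewrite !sumr_const !card_ord -mulrnA -[leLHS]mulr_natl exprMn natrM.
by rewrite expr2 lexx.
Qed.

(** Testing with u = M e_j and v = e_j gives |M e_j|^2 <= 0 for each column. *)
Lemma bilin_le0_eq0 n (M : 'M[R]_n) : bilin_le M 0 -> M = 0.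
Proof.
move=> M0; apply/matrixP => i j.
suff Mj0 : M *m delta_mx j 0 = 0 :> 'cV_n.
  by move: Mj0; rewrite -colE => /colP/(_ i); rewrite !mxE.
have := M0 (M *m delta_mx j 0) (delta_mx j 0).
rewrite mul0r -mulmxA dotmx_norm => /(conj (sqr_ge0 _))/andP/le_anti/esym/eqP.
by rewrite sqrf_eq0 euclnorm_eq0 => /eqP.
Qed.

End EuclideanNorm.

(** * Derivatives and continuity through linear maps *)

Section MatrixCalculus.
Variable R : realType.

Lemma is_derive_linear (V W : normedModType R) (F : {linear V -> W})
    (f : R -> V) (t : R) (df : V) :
  continuous F -> is_derive t (1 : R) f df ->
  is_derive t (1 : R) (F \o f) (F df).
Proof.
move=> cF [fd <-].
have Fcvg : h^-1 *: ((F \o f \o shift t) (h *: 1) - (F \o f) t) @[h --> 0^'] -->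
    F ('D_1 f t).
  have -> : (fun h : R => h^-1 *: ((F \o f \o shift t) (h *: 1) - (F \o f) t)) =
      F \o (fun h => h^-1 *: ((f \o shift t) (h *: 1) - f t)).
    apply/funext => h /=.
    by rewrite linearZ_LR [F (_ - _)]linearB; rewrite scalerBr.
  by apply: cvg_comp; [exact: fd | exact: cF].
by split; [apply/cvg_ex; exists (F ('D_1 f t)) | exact: cvg_lim Fcvg].
Qed.

(** Named as a function of [M] so that it can carry a linear structure; the derivative of u^T Z(s) v
    then comes from that of Z. *)
Definition bilin_eval n (u v : 'cV[R]_n) (M : 'M[R]_n) : R :=
  (u^T *m M *m v) 0 0.

Lemma bilin_eval_is_linear n (u v : 'cV[R]_n) :
  linear (bilin_eval u v : 'M[R]_n -> R).
Proof.
by move=> a M N; rewrite /bilin_eval mulmxDr mulmxDl -scalemxAr -scalemxAl !mxE.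
Qed.

HB.instance Definition _ n (u v : 'cV[R]_n) :=
  GRing.isLinear.Build R 'M[R]_n R _ (bilin_eval u v)
    (@bilin_eval_is_linear n u v).

Lemma linear_le_continuous (V W : normedModType R) (F : {linear V -> W})
    (c : R) :
  (forall x, `|F x| <= c * `|x|) -> continuous F.
Proof.
move=> Fc; apply/linear_bounded_continuous/linear_boundedP.
near=> r => x; apply: le_trans (Fc x) _; rewrite ler_wpM2r//.
Unshelve. all: end_near. Qed.

Lemma bilin_eval_continuous n (u v : 'cV[R]_n) : continuous (bilin_eval u v).
Proof.
pose c := n%:R * (euclnorm u * euclnorm v).
apply: (@linear_le_continuous _ _ _ c) => M; rewrite /c mulrAC.
have le M' : bilin_eval u v M' <= n%:R * `|M'| * (euclnorm u * euclnorm v).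
  exact: bilin_le_norm.
by rewrite ler_norml lerNl -linearN le andbT -(normrN M) le.
Qed.

Lemma trmx_continuous m n : continuous (@trmx R m n).
Proof.
apply: (@linear_le_continuous _ _ _ 1) => M; rewrite mul1r.
rewrite [leLHS]mx_normrE; apply/bigmax_leP; split=> // -[i j] _ /=.
by rewrite [leRHS]mx_normrE mxE (le_bigmax _ (fun ij => `|M ij.1 ij.2|) (j, i)).
Qed.

End MatrixCalculus.

(** * Backward Gronwall comparison for a family of scalar functions *)

Section Gronwall.
Variable R : realType.

(** The derivative of one [phi i] is controlled only through a bound on the whole family; working
    with the family avoids differentiating a supremum. The a priori bound [K] starts an iteration
    whose excess over [y] is halved at each pass and so vanishes in the limit. *)
Lemma backward_gronwall (I : Type) (phi dphi : I -> R -> R) (w : I -> R)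
    (y dy : R -> R) (k b K t0 t1 : R) :
  0 <= k -> 0 <= K -> (forall i, 0 <= w i) ->
  (forall i, {within `[t0, t1], continuous (phi i)}) ->
  (forall i s, t0 < s < t1 -> is_derive s (1 : R) (phi i) (dphi i s)) ->
  (forall s c, t0 < s < t1 -> 0 <= c -> (forall i, phi i s <= c * w i) ->
    forall i, - (k * c + b) * w i <= dphi i s) ->
  (forall i s, t0 <= s <= t1 -> phi i s <= K * w i) ->
  (forall s, is_derive s (1 : R) y (dy s)) ->
  (forall s, t0 <= s <= t1 -> 0 <= y s) ->
  (forall s, t0 <= s <= t1 -> dy s <= - (k * y s + b)) ->
  (forall i, phi i t1 <= y t1 * w i) ->
  forall i s, t0 <= s <= t1 -> phi i s <= y s * w i.
Proof.
move=> k0 K0 w0 cphi dphiP growth phiK dyP y0 dyle phi1.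
pose lam := 2 * k + 1.
pose e s : R := expR (lam * (t1 - s)).
have de s : is_derive s (1 : R) e (- lam * e s).
  have H : is_derive s (1 : R) (fun s : R => lam * (t1 - s)) (- lam).
    by apply: is_derive_eq; rewrite /GRing.scale/=; ring.
  by apply: is_derive_eq; rewrite /GRing.scale/= /e; ring.
have e1 s : s <= t1 -> 1 <= e s.
  move=> st; rewrite -expR0 ler_expR; rewrite /lam; nra.
(* The rate [lam > 2 k] makes each pass halve the excess of [phi] over [y],
   measured by the weight [e]. *)
have halving N : 0 <= N ->
    (forall i s, t0 <= s <= t1 -> phi i s <= (y s + N * e s) * w i) ->
    forall i s, t0 <= s <= t1 -> phi i s <= (y s + N / 2 * e s) * w i.
  move=> N0 phiN i s /andP[t0s st1].
  pose psi r := phi i r - (y r + N / 2 * e r) * w i.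
  pose dpsi r := dphi i r - (dy r + N / 2 * (- lam * e r)) * w i.
  have sub r : r \in `]s, t1[%R -> t0 < r < t1.
    by rewrite in_itv/= => /andP[sr ->]; rewrite andbT (le_lt_trans t0s).
  have dpsiP r : r \in `]s, t1[%R -> is_derive r (1 : R) psi (dpsi r).
    move=> /sub r01.
    have := dphiP i _ r01.
    have := dyP r.
    have := de r.
    move=> ? ? ?.
    by rewrite /psi; apply: is_derive_eq; rewrite /dpsi /GRing.scale/=; ring.
  have cpsi : {within `[s, t1], continuous psi}.
    apply: (@within_continuousB _ _ _ _ (phi i)
      (fun r => (y r + N / 2 * e r) * w i)).
      apply: continuous_subspaceW (cphi i) => z /=.
      by rewrite !in_itv/= => /andP[sz ->]; rewrite andbT (le_trans t0s).
    apply: continuous_subspaceT => z.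
    have d : is_derive z (1 : R) (fun r => (y r + N / 2 * e r) * w i)
        ((dy z + N / 2 * (- lam * e z)) * w i).
      have := dyP z; have := de z => ? ?.
      by apply: is_derive_eq; rewrite /GRing.scale/=; ring.
    apply: differentiable_continuous; apply/derivable1_diffP.
    exact: ex_derive.
  have psi1 : psi t1 <= 0.
    rewrite /psi subr_le0; apply: le_trans (phi1 i) _; rewrite ler_wpM2r//.
    by rewrite lerDl mulr_ge0 ?divr_ge0 ?expR_ge0.
  rewrite -subr_le0 -/(psi s).
  move: st1; rewrite le_eqVlt => /predU1P[-> //|st1].
  have [r rI psiB] := MVT st1 dpsiP cpsi.
  have r01 := sub r rI.
  have r01' : t0 <= r <= t1 by case/andP: r01 => *; rewrite !ltW.
  have yr := y0 r r01'; have er := expR_ge0 (lam * (t1 - r)).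
  have Ne : 0 <= N * e r by rewrite mulr_ge0.
  (* The bound already known for the whole family at [r] is the [c] of the growth condition. *)
  have dphir := growth r _ r01 (addr_ge0 yr Ne) (fun j => phiN j r r01') i.
  (* If [dpsi r] is nonnegative, the mean value theorem gives psi(s) <= psi(t1) <= 0. In [dpsi r]
     the terms [k * y r + b] cancel, and at least [(lam / 2 - k) * (N * e r * w i)] remains, that
     is, half of [N * e r * w i]. *)
  suff d0 : 0 <= dpsi r.
    apply: le_trans psi1; rewrite -subr_ge0 psiB mulr_ge0// subr_ge0.
    exact: ltW.
  have dyr : dy r * w i <= - (k * y r + b) * w i by rewrite ler_wpM2r ?dyle.
  have Nw : 0 <= N * e r * w i by rewrite mulr_ge0.
  rewrite /dpsi /lam; lra.
have iter m i s : t0 <= s <= t1 -> phi i s <= (y s + K / 2 ^+ m * e s) * w i.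
  elim: m i s => [|m IH] i s s01.
    (* The a priori bound suffices here because [y] is nonnegative and [e] is at least 1. *)
    rewrite expr0 divr1; apply: le_trans (phiK i s s01) _.
    rewrite ler_wpM2r//.
    have := y0 s s01; have := e1 s (andP s01).2; nra.
  rewrite exprSr invfM mulrA; apply: halving => //.
  by rewrite divr_ge0// exprn_ge0.
move=> i s s01; apply/ler_addgt0Pr => d d0.
(* The excess after [m] passes is [q / 2 ^+ m * d]; since m < 2^m, any natural [m] above [q] brings
   it below [d]. *)
pose q := K * e s * w i / d.
have q0 : 0 <= q by rewrite !mulr_ge0 ?invr_ge0 ?expR_ge0// ltW.
pose m := (Num.trunc q).+1.
have qm : q <= 2 ^+ m.
  apply: (@le_trans _ _ m%:R); first exact/ltW/truncnS_gt.
  by rewrite -natrX ler_nat ltnW// ltn_expl.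
apply: le_trans (iter m i s s01) _.
have -> : (y s + K / 2 ^+ m * e s) * w i = y s * w i + q / 2 ^+ m * d.
  by rewrite /q; field; rewrite expf_neq0//= gt_eqF.
by rewrite lerD2l ler_piMl ?(ltW d0)// ler_pdivrMr ?exprn_gt0// mul1r.
Qed.

End Gronwall.

(** * The Lyapunov differential equation: comparison, bound, increment and symmetry *)

Section LyapunovEquation.
Variable R : realType.

Lemma within_continuous_norm_bounded (V : normedModType R) (Z : R -> V)
    (t0 t1 : R) :
  {within `[t0, t1], continuous Z} ->
  exists2 K, 0 <= K & forall s, t0 <= s <= t1 -> `|Z s| <= K.
Proof.
move=> cZ; have [t01|t10] := leP t0 t1; last first.
  exists 0 => // s /andP[t0s st1].
  by have := lt_le_trans t10 (le_trans t0s st1); rewrite ltxx.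
have cN : {within `[t0, t1], continuous (fun s => `|Z s|)}.
  by move=> s; apply: cvg_norm; exact: cZ.
have [c cI cmax] := EVT_max t01 cN.
by exists `|Z c| => // s s01; apply: cmax; rewrite in_itv.
Qed.

(** Gronwall over all pairs of vectors, with weight |u| |v|. A common bound [c] on these forms is
    [bilin_le (Z r) c]; the two products with [B] then cost [opnorm B * c] each, whence the rate
    [2 * opnorm B]. *)
Lemma lyap_comparison n (B G0 : 'M[R]_n) (Z : R -> 'M[R]_n) (g0 : R)
    (y dy : R -> R) (t0 t1 : R) :
  {within `[t0, t1], continuous Z} ->
  (forall s, t0 < s < t1 ->
    is_derive s (1 : R) Z (- (B^T *m Z s + Z s *m B + G0))) ->
  bilin_le G0 g0 ->
  (forall s, is_derive s (1 : R) y (dy s)) ->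
  (forall s, t0 <= s <= t1 -> 0 <= y s) ->
  (forall s, t0 <= s <= t1 -> dy s <= - (2 * opnorm B * y s + g0)) ->
  bilin_le (Z t1) (y t1) ->
  forall s, t0 <= s <= t1 -> bilin_le (Z s) (y s).
Proof.
move=> cZ dZ G0g0 dyP y0 dyle Z1 s s01 u v.
have [K K0 ZK] := within_continuous_norm_bounded cZ.
pose w (uv : 'cV[R]_n * 'cV[R]_n) := euclnorm uv.1 * euclnorm uv.2.
pose phi uv r := bilin_eval uv.1 uv.2 (Z r).
pose dphi uv r := bilin_eval uv.1 uv.2 (- (B^T *m Z r + Z r *m B + G0)).
have w0 uv : 0 <= w uv by rewrite mulr_ge0 ?euclnorm_ge0.
apply: (@backward_gronwall R _ phi dphi w y dy (2 * opnorm B) g0 (n%:R * K)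
  t0 t1 _ _ w0 _ _ _ _ dyP y0 dyle _ (u, v) s s01).
- by rewrite mulr_ge0 ?opnorm_ge0.
- by rewrite mulr_ge0.
- move=> uv r; apply: continuous_comp; first exact: cZ.
  exact: bilin_eval_continuous.
- move=> uv r r01; have := dZ r r01.
  by apply: is_derive_linear; exact: bilin_eval_continuous.
- move=> r c r01 c0 Zc uv.
  have Zrc : bilin_le (Z r) c by move=> u' v'; exact: (Zc (u', v')).
  rewrite /dphi linearN mulNr lerN2 mulrDl -mulrA mulrCA.
  have H := bilin_leD (bilin_leD (bilin_le_trmxM B c0 Zrc)
    (bilin_le_mulr B c0 Zrc)) G0g0.
  apply: le_trans (H uv.1 uv.2) _; rewrite /w; lra.
- move=> uv r r01; apply: le_trans (bilin_le_norm _ _ _) _.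
  by rewrite ler_wpM2r ?mulr_ge0 ?euclnorm_ge0// ler_wpM2l// ZK.
- by move=> uv; exact: Z1.
Qed.

Lemma trmx_lyap_op n (B Z G : 'M[R]_n) : G^T = G ->
  (B^T *m Z + Z *m B + G)^T = Z^T *m B + B^T *m Z^T + G.
Proof.
by move=> GT; rewrite linearD /= linearD /= !trmx_mul trmxK GT.
Qed.

(** Each product with [A] absorbs one half of the term [(2 * zeta) *: P]. *)
Lemma lyap_rhs_shiftmx n p (A : 'M[R]_n) (C : 'M[R]_(p, n)) (zeta : R)
    (P : 'M[R]_n) :
  lyap_rhs A C zeta P =
  (shiftmx A zeta)^T *m P + P *m shiftmx A zeta + C^T *m C.
Proof.
rewrite /lyap_rhs /shiftmx [(_ + _)^T]linearD /= tr_scalar_mx mulmxDl mulmxDr.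
rewrite mul_scalar_mx mul_mx_scalar mulr_natl mulr2n scalerDl.
rewrite -!addrA; congr (_ + _); rewrite [RHS]addrCA; congr (_ + _).
by rewrite addrC -addrA.
Qed.

Variables (n p : nat) (A : 'M[R]_n) (C : 'M[R]_(p, n)) (zeta T : R).
Variables (X : 'M[R]_n) (P : R -> 'M[R]_n).
Hypotheses (T0 : 0 < T) (Psol : lyap_solution A C zeta T X P).
Let B := shiftmx A zeta.
Let a := opnorm B.
Let G := C^T *m C.
Let g := opnorm G.
Let a0 : 0 <= a. Proof. exact: opnorm_ge0. Qed.
Let g0 : 0 <= g. Proof. exact: opnorm_ge0. Qed.

Lemma lyap_solution_derive s : 0 < s < T ->
  is_derive s (1 : R) P (- (B^T *m P s + P s *m B + G)).
Proof. by move=> s0T; case: Psol => _ /(_ s s0T); rewrite lyap_rhs_shiftmx. Qed.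

Let expR_backward_ge1 b s : s <= b -> 1 <= expR (2 * a * (b - s)).
Proof. by move=> sb; rewrite -expR0 ler_expR !mulr_ge0// subr_ge0. Qed.

Lemma Pbound_ge0 : 0 <= Pbound A C zeta T X.
Proof.
rewrite mulr_ge0 ?expR_ge0// addr_ge0 ?opnorm_ge0//.
by rewrite mulr_ge0 ?opnorm_ge0// ltW.
Qed.

Lemma lyap_solution_bound s :
  0 <= s <= T -> bilin_le (P s) (Pbound A C zeta T X).
Proof.
move=> s0T; pose e r := expR (2 * a * (T - r)).
(* This [y] equals [opnorm X] at [T] and solves y' = -2 a y - g e; it is a supersolution because e
   >= 1. Enlarging [T - s] to [T] turns [y s] into [Pbound]. *)
pose y r := (opnorm X + (T - r) * g) * e r.
pose dy r := - g * e r - 2 * a * y r.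
have dyP r : is_derive r (1 : R) y (dy r).
  by rewrite /y /e; apply: is_derive_eq; rewrite /dy /y /e /GRing.scale/=; ring.
case: (Psol) => cP _ _ PT.
have Ps : bilin_le (P s) (y s).
  apply: (lyap_comparison cP lyap_solution_derive (@bilin_le_opnorm _ _ G)
    dyP) => //.
  - move=> r /andP[_ rT]; rewrite mulr_ge0 ?expR_ge0// addr_ge0 ?opnorm_ge0//.
    by rewrite mulr_ge0// subr_ge0.
  - move=> r /andP[_ rT]; have : 1 <= e r by exact: expR_backward_ge1.
    move=> /(ler_peMr g0); rewrite /dy -/a -/g. lra.
  - rewrite PT /y /e subrr mul0r addr0 mulr0 expR0 mulr1.
    exact: bilin_le_opnorm.
move=> u v; apply: le_trans (Ps u v) _.
rewrite ler_wpM2r ?mulr_ge0 ?euclnorm_ge0//; case/andP: s0T => s0 sT.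
rewrite /y /Pbound ler_pM ?expR_ge0//.
- by rewrite addr_ge0 ?opnorm_ge0// mulr_ge0// subr_ge0.
- by rewrite lerD2l ler_wpM2r// gerBl.
- by rewrite ler_expR mulrAC ler_wpM2r// ler_wpM2l// gerBl.
Qed.

(** Subtracting the constant [P tau] keeps the homogeneous part of the equation and adds
    [B^T *m P tau + P tau *m B] to the source, which costs at most 2 a [Pb]. *)
Lemma lyap_solution_increment t tau : 0 <= t <= tau -> tau <= T ->
  bilin_le (P t - P tau) (vartheta A C zeta T X (tau - t)).
Proof.
move=> /andP[t0 ttau] tauT; pose Pb := Pbound A C zeta T X.
have Pb0 : 0 <= Pb := Pbound_ge0.
pose e r := expR (2 * a * (tau - r)).
(* Chosen to vanish at [tau], to satisfy y' = -2 a (y + [Pb]) - g e, and to take exactly the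
   [vartheta] value at [t]. *)
pose y r := g * (tau - r) * e r + Pb * (e r - 1).
pose dy r := - g * e r - 2 * a * (y r + Pb).
have dyP r : is_derive r (1 : R) y (dy r).
  by rewrite /y /e; apply: is_derive_eq; rewrite /dy /y /e /GRing.scale/=; ring.
have -> : vartheta A C zeta T X (tau - t) = y t.
  rewrite /vartheta -/B -/a -/G -/g -/Pb /y /e.
  have -> : expR (2 * a * (tau - t)) = expR (a * (tau - t)) ^+ 2.
    by rewrite -expRM_natl; congr expR; ring.
  ring.
have cP : {within `[t, tau], continuous P}.
  case: Psol => + _ _ _; apply: continuous_subspaceW => r /=.
  by rewrite !in_itv/= => /andP[? ?]; rewrite (le_trans t0) ?(le_trans _ tauT).
have Ptau := lyap_solution_bound (introT andP (conj (le_trans t0 ttau) tauT)).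
have G0 : bilin_le (B^T *m P tau + P tau *m B + G) (a * Pb + a * Pb + g).
  apply: bilin_leD (@bilin_le_opnorm _ _ _); apply: bilin_leD.
    exact: bilin_le_trmxM.
  exact: bilin_le_mulr.
apply: (@lyap_comparison _ B _ (fun r => P r - P tau) _ y dy t tau _ _ G0
  dyP) => //.
- apply: (@within_continuousB _ _ _ _ P (fun=> P tau)) => //.
  by apply: continuous_subspaceT; exact: cst_continuous.
- move=> r /andP[tr rtau].
  have r0T : 0 < r < T by rewrite (le_lt_trans t0) ?(lt_le_trans rtau).
  have := lyap_solution_derive r0T => ?.
  apply: is_derive_eq; rewrite subr0; congr (- _).
  by rewrite mulmxBr mulmxBl [X in _ = X + _]addrACA -opprD addrA addrNK.
- move=> r /andP[_ rtau]; have : 1 <= e r by exact: expR_backward_ge1.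
  move=> er1; have er0 : 0 <= e r by exact: expR_ge0.
  by rewrite /y addr_ge0// ?(mulr_ge0 Pb0)// ?mulr_ge0// subr_ge0.
- move=> r /andP[_ rtau]; have : 1 <= e r by exact: expR_backward_ge1.
  move=> /(ler_peMr g0); rewrite /dy -/a. lra.
- move=> u v; rewrite subrr mulmx0 mul0mx mxE /y /e subrr !mulr0 expR0.
  by rewrite subrr mulr0 !mul0r addr0 mul0r.
- by rewrite lexx.
Qed.

(** Symmetry is not a clause of [lyap_solution], while [posdef] demands it of [Psi]. The source C^T
    C is symmetric, so it cancels in the equation for P - P^T. *)
Lemma lyap_solution_sym : X^T = X -> forall s, 0 <= s <= T -> (P s)^T = P s.
Proof.
move=> Xsym s s0T; case: (Psol) => cP _ _ PT.
have Z0 : bilin_le (P s - (P s)^T) 0.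
  have G0 : bilin_le (0 : 'M[R]_n) 0.
    by move=> u v; rewrite mulmx0 mul0mx mxE mul0r.
  apply: (@lyap_comparison _ B 0 (fun r => P r - (P r)^T) 0 (fun=> 0) (fun=> 0)
    0 T _ _ G0) => //.
  - apply: (@within_continuousB _ _ _ _ P (fun r => (P r)^T)) => // r.
    by apply: continuous_comp; [exact: cP|exact: trmx_continuous].
  - move=> r r0T; have dP := lyap_solution_derive r0T.
    have := is_derive_linear (@trmx_continuous R n n) dP => /= dPT.
    apply: is_derive_eq; rewrite addr0 [(- _)^T]linearN /= -opprD; congr (- _).
    have GT : G^T = G by rewrite trmx_mul trmxK.
    rewrite (trmx_lyap_op B (P r) GT) mulmxBr mulmxBl.
    by rewrite [_ + B^T *m _]addrC opprD addrACA subrr addr0 opprD addrACA.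
  - by move=> r _; rewrite mulr0 addr0 oppr0.
  - by rewrite PT Xsym subrr.
by apply/esym/eqP; rewrite -subr_eq0; apply/eqP/bilin_le0_eq0.
Qed.

End LyapunovEquation.

(** * Effect on [Psi] of a change in [P] *)

Section Perturbation.
Variable R : realType.

(** Monotonicity replaces the distance from [t] to its grid node by [mu]; nonnegativity is the sign
    condition of [Psi_lin_le]. *)
Lemma vartheta_ge0_le n p (A : 'M[R]_n) (C : 'M[R]_(p, n)) (zeta T : R)
    (X : 'M[R]_n) (s mu : R) :
  0 < T -> 0 <= s <= mu ->
  0 <= vartheta A C zeta T X s <= vartheta A C zeta T X mu.
Proof.
move=> T0 /andP[s0 smu]; rewrite /vartheta.
set a := opnorm (shiftmx A zeta); set g := opnorm _.
have a0 : 0 <= a := opnorm_ge0 _.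
have g0 : 0 <= g := opnorm_ge0 _.
have Pb0 := Pbound_ge0 A C zeta X T0; set Pb := Pbound _ _ _ _ _ in Pb0 *.
have es : 1 <= expR (a * s) by rewrite -expR0 ler_expR mulr_ge0.
have esmu : expR (a * s) <= expR (a * mu) by rewrite ler_expR ler_wpM2l.
apply/andP; split.
  apply: addr_ge0; first by rewrite !mulr_ge0 ?expR_ge0.
  apply: mulr_ge0 => //; nra.
apply: lerD; first apply: ler_wpM2r => //.
  by rewrite ler_pM ?expR_ge0// ler_expR ler_wpM2l// mulr_ge0.
apply: ler_wpM2r => //; nra.
Qed.

(** The bound on [N] makes [e%:M - N] positive semidefinite; strictness comes from [S]. *)
Lemma posdef_perturb n (S N : 'M[R]_n) (e : R) :
  posdef S -> N^T = N ->
  (forall x : 'cV[R]_n, (x^T *m N *m x) 0 0 <= e * euclnorm x ^+ 2) ->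
  posdef (S + (e%:M - N)).
Proof.
move=> [ST S0] NT Ne; split => [|x x0].
  by rewrite linearD /= ST linearB /= NT tr_scalar_mx.
rewrite mulmxDr mulmxDl mulmxBr mulmxBl mul_mx_scalar -scalemxAl.
rewrite mxE [X in _ < _ + X]mxE [X in _ < _ + (X + _)]mxE.
rewrite [X in _ < _ + (_ + X)]mxE dotmx_norm.
by rewrite ltr_pwDl ?S0// subr_ge0.
Qed.

(* The part of [Psi] that is linear in [P t]. *)
Definition Psi_lin n (LD : 'M[R]_n) (zeta alpha : R) (Delta : 'M[R]_n) :
    'M[R]_(n + (n + (n + n))) :=
  symblock (- (2 * (zeta - alpha)) *: Delta)
    (row_mx (Delta *m LD) (row_mx (- (Delta *m LD)) 0)) 0.

Lemma Psi_sub n m (A : 'M[R]_n) (L : 'M[R]_(n, m)) (D : 'M[R]_(m, n))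
    (zeta alpha h gamma kappa : R) (W Q : 'M[R]_n) (P : R -> 'M[R]_n)
    (t tau : R) :
  Psi A L D zeta alpha h gamma kappa W Q P t =
  Psi A L D zeta alpha h gamma kappa W Q P tau
  + Psi_lin (L *m D) zeta alpha (P t - P tau).
Proof.
rewrite /Psi /Psi_lin /symblock.
set g := (_)%:M.
rewrite [in RHS]add_block_mx -linearD /= add_row_mx add_row_mx !addr0.
have PLD : P tau *m (L *m D) + (P t - P tau) *m (L *m D) = P t *m (L *m D).
  by rewrite mulmxBl addrC subrK.
congr (block_mx _ _ _ _).
- by rewrite scalerBr addrAC [_ + (_ - _)]addrC subrK.
- by rewrite addrAC PLD -opprD PLD.
- by rewrite addrAC PLD -opprD PLD.
Qed.

Lemma trmx_Psi_lin n (LD : 'M[R]_n) (zeta alpha : R) (Delta : 'M[R]_n) :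
  Delta^T = Delta ->
  (Psi_lin LD zeta alpha Delta)^T = Psi_lin LD zeta alpha Delta.
Proof. by move=> DT; rewrite tr_block_mx trmxK trmx0 linearZ /= DT. Qed.

Lemma Psi_lin_le n (LD : 'M[R]_n) (zeta alpha d : R) (Delta : 'M[R]_n)
    (x : 'cV[R]_(n + (n + (n + n)))) :
  alpha < zeta -> 0 <= d -> bilin_le Delta d ->
  (x^T *m Psi_lin LD zeta alpha Delta *m x) 0 0 <=
  d * (2 * (zeta - alpha + opnorm LD)) * euclnorm x ^+ 2.
Proof.
move=> az d0 Dd.
rewrite -(vsubmxK x); set x1 := usubmx x; set x' := dsubmx x.
rewrite -(vsubmxK x'); set x2 := usubmx x'; set x'' := dsubmx x'.
rewrite -(vsubmxK x''); set x3 := usubmx x''; set x4 := dsubmx x''.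
rewrite !sqr_euclnorm_col_mx.
(* The off-diagonal blocks for [x2] and [x3] are opposite, so together they act on [x2 - x3], and
   [x4] meets only zero blocks. *)
set w := LD *m (x2 - x3).
have -> : (col_mx x1 (col_mx x2 (col_mx x3 x4)))^T
    *m Psi_lin LD zeta alpha Delta *m col_mx x1 (col_mx x2 (col_mx x3 x4)) =
    - (2 * (zeta - alpha)) *: (x1^T *m Delta *m x1)
    + (x1^T *m Delta *m w + (x1^T *m Delta *m w)^T).
  rewrite /Psi_lin /symblock.
  set B := row_mx _ _.
  have Bx : B *m col_mx x2 (col_mx x3 x4) = Delta *m w.
    by rewrite !mul_row_col mul0mx addr0 mulNmx -mulmxBr -mulmxA.
  rewrite -mulmxA mul_block_col mul0mx addr0 tr_col_mx mul_row_col Bx.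
  rewrite mulmxDr -scalemxAl -scalemxAr -[in RHS]mulmxA -[x1^T *m _ *m w]mulmxA.
  rewrite -addrA; congr (_ + (_ + _)).
  by rewrite mulmxA -trmx_mul Bx [RHS]trmx_mul trmxK.
have entryE (a : R) (S S' : 'M[R]_1) :
    (a *: S + (S' + S'^T)) 0 0 = a * S 0 0 + (S' 0 0 + S' 0 0) by rewrite !mxE.
rewrite entryE.
have H1 := bilin_leN Dd x1 x1.
have H2 := Dd x1 w.
have w_le : euclnorm w <= opnorm LD * euclnorm (x2 - x3).
  exact: euclnorm_mulmx_le.
have q_le := sqr_euclnormB_le x2 x3.
rewrite mulmxN mulNmx mxE in H1.
have l0 : 0 <= opnorm LD := opnorm_ge0 _.
have S1 : - (2 * (zeta - alpha)) * (x1^T *m Delta *m x1) 0 0 <=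
    2 * (zeta - alpha) * (d * (euclnorm x1 * euclnorm x1)).
  by rewrite mulNr -mulrN ler_wpM2l// mulr_ge0// subr_ge0 ltW.
have S2 : (x1^T *m Delta *m w) 0 0 <=
    d * (opnorm LD * (euclnorm x1 * euclnorm (x2 - x3))).
  by apply: le_trans H2 _; rewrite ler_wpM2l// mulrCA ler_wpM2l// euclnorm_ge0.
(* 2 |x1| |x2 - x3| <= |x1|^2 + |x2 - x3|^2, and |x2 - x3|^2 <= 2 (|x2|^2 + |x3|^2): this is the
   origin of the factor 2 before [opnorm LD]. *)
have AMGM : 2 * (euclnorm x1 * euclnorm (x2 - x3)) <=
    2 * (euclnorm x1 ^+ 2 + (euclnorm x2 ^+ 2 + (euclnorm x3 ^+ 2
    + euclnorm x4 ^+ 2))).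
  have := sqr_ge0 (euclnorm x1 - euclnorm (x2 - x3)).
  have := sqr_ge0 (euclnorm x1); have := sqr_ge0 (euclnorm x4); nra.
have S3 := ler_wpM2l (mulr_ge0 d0 l0) AMGM.
(* The diagonal term involves [x1] alone; this pads its bound to the full squared norm. *)
have S4 : 0 <= 2 * (zeta - alpha) * (d * (euclnorm x2 ^+ 2 + (euclnorm x3 ^+ 2
    + euclnorm x4 ^+ 2))).
  by rewrite !mulr_ge0 ?subr_ge0 ?(ltW az)// !addr_ge0// sqr_ge0.
lra.
Qed.

End Perturbation.

(** * Location of [t] in the grid and conclusion *)

Lemma grid_cell (R : realType) (tau : nat -> R) (M : nat) (t : R) :
  (0 < M)%N -> tau 0%N <= t <= tau M ->
  exists2 k, (k < M)%N & tau k <= t <= tau k.+1.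
Proof.
elim: M => // -[_ _ t01|M IH _ /andP[t0 tM]]; first by exists 0%N.
have [tM'|tM'] := leP t (tau M.+1); last by exists M.+1; rewrite // ltW.
by have [//||k kM kt] := IH; [rewrite t0|exists k; rewrite // ltnW].
Qed.

Lemma grid_le_last (R : realType) (tau : nat -> R) (M k : nat) :
  (forall j, (j < M)%N -> tau j < tau j.+1) -> (k <= M)%N -> tau k <= tau M.
Proof.
elim: M => [_|M IH tau_lt]; first by rewrite leqn0 => /eqP ->.
rewrite leq_eqVlt => /predU1P[-> //|kM].
apply: (le_trans (IH _ kM)) => [j jM|]; last exact/ltW/tau_lt.
by apply: tau_lt; rewrite ltnW.
Qed.

Theorem theorem4 (R : realType) (l n m p : nat)
  (A : 'I_l -> 'M[R]_n) (D : 'I_l -> 'M[R]_(m, n)) (L : 'I_l -> 'M[R]_(n, m))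
  (C : 'M[R]_(p, n)) (T : R) (X : 'I_l -> 'M[R]_n)
  (P : 'I_l -> R -> 'M[R]_n)
  (i : 'I_l) (M : nat) (tau : nat -> R)
  (eps zeta alpha mu h gamma kappa : R) (W Q : 'M[R]_n) :
  0 < T ->
  (forall j : 'I_l, posdef (X j)) ->
  (forall j : 'I_l, lyap_solution (A j) C zeta T (X j) (P j)) ->
  tau 0%N = 0 -> tau M = T ->
  (forall j : nat, (j < M)%N -> tau j < tau j.+1) ->
  0 < eps -> 0 < zeta -> 0 < alpha < zeta ->
  0 < mu ->
  \big[Num.max/0]_(j < M) (tau j.+1 - tau j) < mu ->
  vartheta (A i) C zeta T (X i) mu
    < eps / (2 * (zeta - alpha + opnorm (L i *m D i))) ->
  0 < h -> 0 < gamma -> 0 < kappa ->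
  posdef W -> posdef Q ->
  (forall k : nat, (1 <= k <= M)%N ->
     mxprec (Psi (A i) (L i) (D i) zeta alpha h gamma kappa W Q (P i) (tau k))
            (- eps%:M)) ->
  forall t : R, 0 <= t <= T ->
    mxprec (Psi (A i) (L i) (D i) zeta alpha h gamma kappa W Q (P i) t) 0.
Proof.
move=> T0 Xpd Psol tau0 tauM tau_lt eps0 zeta0 /andP[_ az] mu0 mesh vmu.
move=> h0 gamma0 kappa0 Wpd Qpd Psi_tau t t0T.
(* With [M = 0] the two end conditions would force [T = 0]. *)
have M0 : (0 < M)%N.
  by case: M tauM {tau_lt mesh Psi_tau} => // H; move: T0; rewrite -H tau0 ltxx.
(* The right end of the cell is the comparison node: the estimates on [P] run backward in time, and
   the indices [k.+1] cover 1 to [M], where the matrix inequality is assumed. Closed cells include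
   [t = 0]. *)
have [k kM /andP[tk tk1]] : exists2 k, (k < M)%N & tau k <= t <= tau k.+1.
  by apply: grid_cell => //; rewrite tau0 tauM.
have /andP[t0 tT] := t0T.
have tk1T : tau k.+1 <= T by rewrite -tauM; exact: grid_le_last.
have smu : 0 <= tau k.+1 - t <= mu.
  rewrite subr_ge0 tk1 /=; apply: le_trans (ltW mesh).
  apply: le_trans (le_bigmax _ (fun j : 'I_M => tau j.+1 - tau j) (Ordinal kM)).
  by rewrite lerD2l lerN2.
have /andP[v0 vle] := vartheta_ge0_le (A i) C zeta (X i) T0 smu.
have Delta_le :
    bilin_le (P i t - P i (tau k.+1)) (vartheta (A i) C zeta T (X i) mu).
  apply: bilin_le_weaken vle _; apply: lyap_solution_increment => //.
  by rewrite t0.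
have Delta_sym : (P i t - P i (tau k.+1))^T = P i t - P i (tau k.+1).
  have Psym := lyap_solution_sym (Psol i) (Xpd i).1.
  by rewrite linearB /= !Psym// tk1T (le_trans t0).
have d0 : 0 < 2 * (zeta - alpha + opnorm (L i *m D i)).
  by rewrite mulr_gt0// ltr_wpDr ?opnorm_ge0// subr_gt0.
have := Psi_tau k.+1 kM; rewrite /mxprec => Stau.
rewrite (Psi_sub _ _ _ _ _ _ _ _ _ _ _ t (tau k.+1)).
set N := Psi_lin _ _ _ _; set S := Psi _ _ _ _ _ _ _ _ _ _ _ _ in Stau *.
(* The margin [eps] available at the node is spent on the perturbation [N]. *)
have -> : 0 - (S + N) = (- eps%:M - S) + (eps%:M - N).
  by rewrite sub0r opprD addrACA addNr add0r.
apply: posdef_perturb => //; first exact: trmx_Psi_lin.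
(* The assumed bound on [vartheta] at [mu] says precisely that the coefficient from [Psi_lin_le] is
   below [eps]. *)
move=> x; apply: le_trans (Psi_lin_le _ _ az (le_trans v0 vle) Delta_le) _.
by rewrite ler_wpM2r ?sqr_ge0// ltW// -ltr_pdivlMr.
Qed.
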